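(* Consider the fractional program (FP) defined in the context. It has a convex objective function and convex constraints, except for the constraint $\|\hat s\|^2+\|\hat b\|^2+\hat v^2\ge 1$, provided $\rho\ge 1+\frac{\sqrt{m_d+N}}{2}$.
   Context: Data: integers $n,d,N\ge 1$, inputs $x^{(k)}\in\mathbb{R}^n$ and outputs $y^{(k)}\in\mathbb{R}$ for $k=1,\dots,N$. $\Gamma_d=\{\alpha\in\mathbb{Z}_{\ge0}^n : \sum_i\alpha_i\le d\}$, $m_d=|\Gamma_d|$, and $x^\alpha=\prod_i x_i^{\alpha_i}$. Vectors $\hat c,\hat s\in\mathbb{R}^{m_d}$ are indexed by $\alpha\in\Gamma_d$. $M>0$ is a given large constant, $l_b,l_m$ are positive integers, $\rho$ is a positive real constant, and $\|\cdot\|$ is the Euclidean norm. The fractional program (FP): minimize $\hat\gamma/\hat v$ over $\hat c\in\mathbb{R}^{m_d},\hat s\in\mathbb{R}^{m_d},\hat b\in\mathbb{R}^N,\hat\gamma\in\mathbb{R},\hat v\in\mathbb{R}$ subject to $-M\hat v+\frac{\sqrt{\rho-1}}{\sqrt\rho}M\hat b_k+\left|y^{(k)}\hat v-\sum_{\alpha\in\Gamma_d}\hat c_\alpha (x^{(k)})^\alpha\right|\le\hat\gamma$ for all $k\in\{1,\dots,N\}$; $-\frac{\sqrt{\rho-1}}{\sqrt\rho}M\hat s_\alpha\le\hat c_\alpha\le\frac{\sqrt{\rho-1}}{\sqrt\rho}M\hat s_\alpha$ for all $\alpha\in\Gamma_d$; $0\le\hat s_\alpha\le\frac{\sqrt\rho}{\sqrt{\rho-1}}\hat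 v$ for all $\alpha\in\Gamma_d$; $0\le\hat b_k\le\frac{\sqrt\rho}{\sqrt{\rho-1}}\hat v$ for all $k\in\{1,\dots,N\}$; $\sum_{k=1}^N\hat b_k=l_b\frac{\sqrt\rho}{\sqrt{\rho-1}}\hat v$; $\sum_{\alpha\in\Gamma_d}\hat s_\alpha=l_m\frac{\sqrt\rho}{\sqrt{\rho-1}}\hat v$; $\hat v=\frac{\sqrt{\rho-1}}{\sqrt{\rho(m_d+N+1)-1}}$; $\frac{(\rho-1)(\|\hat s\|^2+\|\hat b\|^2)}{\rho}+\frac{\hat v}{\sqrt\rho\sqrt{\rho-1}}\left(\sum_{\alpha\in\Gamma_d}\hat s_\alpha+\sum_{k=1}^N\hat b_k\right)+\hat v^2\le1$; $\|\hat s\|^2+\|\hat b\|^2+\hat v^2\ge1$.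
   Formalization: The objective γ̂/v̂ is not jointly convex on v̂ > 0, so its convexity is stated on the affine set where v̂ equals the constant prescribed by the equality constraint of (FP), which contains all feasible points. *)

(* Defs.v *)
From HB Require Import structures.
From mathcomp Require Import all_boot all_order all_algebra.
From mathcomp Require Import boolp classical_sets reals convex.

Set Implicit Arguments.
Unset Strict Implicit.
Unset Printing Implicit Defensive.

Import Order.TTheory GRing.Theory Num.Theory.

Local Open Scope classical_set_scope.
Local Open Scope ring_scope.

Section Constraints.
Context {R : realType} {V : lmodType R}.

Definition affine_function (f : V -> R) : Prop :=
  forall (t : R) (z w : V),
    f (t *: z + (1 - t) *: w) = t * f z + (1 - t) * f w.

Inductive constraint :=
  | Leq of (V -> R) & (V -> R)
  | Equ of (V -> R) & (V -> R).

Definition satisfying (c : constraint) : set V :=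
  match c with
  | Leq f g => [set z | f z <= g z]
  | Equ f g => [set z | f z = g z]
  end.

(* In the standard sense of convex programming: an inequality is convex when
   it reads h <= 0 with h convex on the whole space, an equality is convex
   when it reads h = 0 with h affine. *)
Definition convex_constraint (c : constraint) : Prop :=
  match c with
  | Leq f g => @convex_function R V setT (fun z => f z - g z)
  | Equ f g => affine_function (fun z => f z - g z)
  end.

End Constraints.

Arguments constraint {R} V.

(* A multi-index whose entries sum to at most d has all its entries at most d,
   so taking the entries in 'I_d.+1 loses nothing. *)
Definition Gamma (n d : nat) : finType :=
  {alpha : {ffun 'I_n -> 'I_d.+1} | (\sum_(i < n) alpha i <= d)%N}.

Definition monomial (R : realType) (n d : nat) (u : 'rV[R]_n)
    (alpha : Gamma n d) : R :=
  \prod_(i < n) u 0 i ^+ (val alpha i).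

Definition enorm (R : realType) (I : finType) (u : {ffun I -> R^o}) : R :=
  Num.sqrt (\sum_i u i ^+ 2).

Section FractionalProgram.
Context {R : realType} {n d N : nat}.
Variables (x : 'I_N -> 'rV[R]_n) (y : 'I_N -> R).
Variables (M rho : R) (lb lm : nat).

(* The decision vector (c, s, b, gamma, v). *)
Definition fp_space : lmodType R :=
  ({ffun Gamma n d -> R^o} * {ffun Gamma n d -> R^o} * {ffun 'I_N -> R^o}
    * R^o * R^o)%type.

Definition fp_c (z : fp_space) : {ffun Gamma n d -> R^o} := z.1.1.1.1.
Definition fp_s (z : fp_space) : {ffun Gamma n d -> R^o} := z.1.1.1.2.
Definition fp_b (z : fp_space) : {ffun 'I_N -> R^o} := z.1.1.2.
Definition fp_gamma (z : fp_space) : R := z.1.2.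
Definition fp_v (z : fp_space) : R := z.2.

(* This quotient is not jointly convex on v > 0; it is convex on the set of
   solutions of the constraint VFixed below, where v has a prescribed
   positive value. *)
Definition fp_objective (z : fp_space) : R := fp_gamma z / fp_v z.

Inductive fp_label :=
  | Residual of 'I_N
  | CLower of Gamma n d
  | CUpper of Gamma n d
  | SLower of Gamma n d
  | SUpper of Gamma n d
  | BLower of 'I_N
  | BUpper of 'I_N
  | BSum
  | SSum
  | VFixed
  | Ellipsoid
  | ReverseBall.

Definition fp_constraint (l : fp_label) : constraint fp_space :=
  let r := Num.sqrt (rho - 1) / Num.sqrt rho in
  let r' := Num.sqrt rho / Num.sqrt (rho - 1) in
  match l with
  | Residual k =>
      Leq (fun z => - M * fp_v z + r * M * fp_b z k
             + `| y k * fp_v z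
                  - \sum_(a : Gamma n d) fp_c z a * monomial (x k) a |)
          fp_gamma
  | CLower a => Leq (fun z => - (r * M * fp_s z a)) (fun z => fp_c z a)
  | CUpper a => Leq (fun z => fp_c z a) (fun z => r * M * fp_s z a)
  | SLower a => Leq (fun=> 0) (fun z => fp_s z a)
  | SUpper a => Leq (fun z => fp_s z a) (fun z => r' * fp_v z)
  | BLower k => Leq (fun=> 0) (fun z => fp_b z k)
  | BUpper k => Leq (fun z => fp_b z k) (fun z => r' * fp_v z)
  | BSum => Equ (fun z => \sum_(k < N) fp_b z k)
                (fun z => lb%:R * r' * fp_v z)
  | SSum => Equ (fun z => \sum_(a : Gamma n d) fp_s z a)
                (fun z => lm%:R * r' * fp_v z)
  | VFixed =>
      Equ fp_v
          (fun=> Num.sqrt (rho - 1)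
                 / Num.sqrt (rho * (#|Gamma n d| + N + 1)%:R - 1))
  | Ellipsoid =>
      Leq (fun z =>
             (rho - 1) * (enorm (fp_s z) ^+ 2 + enorm (fp_b z) ^+ 2) / rho
             + fp_v z / (Num.sqrt rho * Num.sqrt (rho - 1))
               * (\sum_(a : Gamma n d) fp_s z a + \sum_(k < N) fp_b z k)
             + fp_v z ^+ 2)
          (fun=> 1)
  | ReverseBall =>
      Leq (fun=> 1)
          (fun z => enorm (fp_s z) ^+ 2 + enorm (fp_b z) ^+ 2 + fp_v z ^+ 2)
  end.

End FractionalProgram.

Arguments fp_label n d N : clear implicits.
Arguments fp_space R n d N : clear implicits.

(* Main.v *)
(* The quadratic form of the Ellipsoid constraint is a sum of squares: with
   K = m_d + N and a = (rho - 1) / rho, completing the squares in the entries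
   of s and b leaves the coefficient 1 - K / (4 (rho - 1)^2) in front of v^2,
   which is nonnegative exactly when rho >= 1 + sqrt K / 2. The remaining
   convex constraints are affine up to an absolute value. ReverseBall is
   refuted by the points v = 1 and v = -1, whose midpoint is the origin. *)
Require Import Defs.
From mathcomp Require Import all_boot all_order all_algebra ring lra.
From mathcomp Require Import interval_inference.
From mathcomp Require Import boolp classical_sets reals convex.

Set Implicit Arguments.
Unset Strict Implicit.
Unset Printing Implicit Defensive.

Import Order.TTheory GRing.Theory Num.Theory.

Local Open Scope classical_set_scope.
Local Open Scope ring_scope.

(** * Closure properties of convex and affine functions on a real vector space *)

Section ConvexFunctions.
Context {R : realType} {V : lmodType R}.
Implicit Types f g : V -> R.

(** This trades the bundled interval-valued weight of [convex_function] for a real [t] with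
    [0 <= t <= 1], so that the convexity proofs below become computations in [R]. *)
Lemma convexTP f :
  @convex_function R V setT f <->
  forall (t : R) (z w : V), 0 <= t <= 1 ->
    f (t *: z + (1 - t) *: w) <= t * f z + (1 - t) * f w.
Proof.
split=> [cf t z w t01|cf t z w _ _]; last first.
  exact: (cf t%:num z w (introT andP (conj (ge0 t) (le1 t)))).
exact: (cf (Itv01 (proj1 (andP t01)) (proj2 (andP t01))) z w (in_setT _)
  (in_setT _)).
Qed.

Lemma convex_affine f : affine_function f -> @convex_function R V setT f.
Proof. by move=> af; apply/convexTP => t z w _; rewrite af. Qed.

Lemma convexD f g : @convex_function R V setT f ->
  @convex_function R V setT g ->
  @convex_function R V setT (fun z => f z + g z).
Proof.
move=> /convexTP cf /convexTP cg; apply/convexTP => t z w t01.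
by rewrite !mulrDr addrACA lerD ?cf ?cg.
Qed.

Lemma convex_sum (I : finType) (F : I -> V -> R) :
  (forall i, @convex_function R V setT (F i)) ->
  @convex_function R V setT (fun z => \sum_i F i z).
Proof.
move=> cF; apply/convexTP => t z w t01.
rewrite !mulr_sumr -big_split /=; apply: ler_sum => i _.
by move/convexTP: (cF i); apply.
Qed.

Lemma convexZ (k : R) f : 0 <= k -> @convex_function R V setT f ->
  @convex_function R V setT (fun z => k * f z).
Proof.
move=> k0 /convexTP cf; apply/convexTP => t z w t01.
by rewrite ![_ * (k * _)]mulrCA -mulrDr ler_wpM2l ?cf.
Qed.

Lemma convex_norm f : affine_function f ->
  @convex_function R V setT (fun z => `|f z|).
Proof.
move=> af; apply/convexTP => t z w /andP[t0 t1]; rewrite af.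
rewrite (le_trans (ler_normD _ _))// !normrM (ger0_norm t0).
by rewrite (@ger0_norm _ (1 - t)) ?subr_ge0.
Qed.

Lemma convex_sqr f : affine_function f ->
  @convex_function R V setT (fun z => f z ^+ 2).
Proof.
move=> af; apply/convexTP => t z w /andP[t0 t1]; rewrite af -subr_ge0.
(* For affine [f] the convexity gap of the square is exactly the variance of the two values under
   the weights [t] and [1 - t]. *)
have -> : t * f z ^+ 2 + (1 - t) * f w ^+ 2 - (t * f z + (1 - t) * f w) ^+ 2
  = t * (1 - t) * (f z - f w) ^+ 2 by ring.
by rewrite mulr_ge0 ?sqr_ge0// mulr_ge0 ?subr_ge0.
Qed.

Lemma affine_cst (k : R) : affine_function (fun _ : V => k).
Proof. by move=> t z w; ring. Qed.

Lemma affineD f g : affine_function f -> affine_function g ->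
  affine_function (fun z => f z + g z).
Proof. by move=> af ag t z w; rewrite af ag; ring. Qed.

Lemma affineZ (k : R) f : affine_function f ->
  affine_function (fun z => k * f z).
Proof. by move=> af t z w; rewrite af; ring. Qed.

Lemma affineZr (k : R) f : affine_function f ->
  affine_function (fun z => f z * k).
Proof. by move=> af t z w; rewrite af; ring. Qed.

Lemma affineN f : affine_function f -> affine_function (fun z => - f z).
Proof. by move=> af t z w; rewrite af; ring. Qed.

Lemma affine_sum (I : finType) (F : I -> V -> R) :
  (forall i, affine_function (F i)) ->
  affine_function (fun z => \sum_i F i z).
Proof.
move=> aF t z w; rewrite !mulr_sumr -big_split /=.
by apply: eq_bigr => i _; rewrite aF.
Qed.

(** Since [g] is affine, a convex combination of two points of the level set stays in it, so the
    denominator is [k] at all three points and the quotient behaves there like the affine function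
    [f z / k]. *)
Lemma convex_quotient_fixed_denominator f g (k : R) :
  affine_function f -> affine_function g ->
  @convex_function R V [set z | g z = k] (fun z => f z / g z).
Proof.
move=> af ag t z w; rewrite !inE /= => gz gw.
have afzw : f (conv t (z : convex_lmodType V) w)
  = t%:num * f z + (1 - t%:num) * f w := af t%:num z w.
have agzw : g (conv t (z : convex_lmodType V) w)
  = t%:num * g z + (1 - t%:num) * g w := ag t%:num z w.
rewrite convRE afzw agzw gz gw (_ : t%:num * k + _ = k); last by ring.
by rewrite mulrDl -!mulrA.
Qed.

(** A sublevel set of a convex function is convex. Its contrapositive turns a failure of convexity
    of the solution set into a failure for the constraint itself. *)
Lemma convex_constraint_Leq_set f g : convex_constraint (Leq f g) ->
  @convex_set R V (satisfying (Leq f g)).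
Proof.
move=> cfg z w t; rewrite !inE /= => fgz fgw.
rewrite -subr_le0; apply: le_trans (cfg t z w (in_setT _) (in_setT _)) _.
rewrite convRE -oppr_ge0 opprD -!mulrN.
by rewrite addr_ge0// mulr_ge0 ?subr_ge0// opprB subr_ge0.
Qed.

End ConvexFunctions.

Lemma enorm_sqr (R : realType) (I : finType) (u : {ffun I -> R^o}) :
  enorm u ^+ 2 = \sum_i u i ^+ 2.
Proof. by rewrite sqr_sqrtr// sumr_ge0// => i _; rewrite sqr_ge0. Qed.

Lemma sum_sqr_shift (R : realType) (I : finType) (F : I -> R) (h : R) :
  \sum_i (F i + h) ^+ 2
  = \sum_i F i ^+ 2 + 2 * h * (\sum_i F i) + #|I|%:R * h ^+ 2.
Proof.
under eq_bigr do rewrite sqrrD -mulr_natr.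
rewrite !big_split /= sumr_const mulr_natl -!mulr_suml; ring.
Qed.

(** * Convexity of the constraints of the fractional program *)

Section FractionalProgramConvexity.
Context {R : realType} {n d N : nat}.
Local Notation V := (fp_space R n d N).
Implicit Types z w : V.

Lemma affine_fp_c a : affine_function (fun z => fp_c z a : R).
Proof. by move=> t z w; rewrite /fp_c /= !ffunE. Qed.

Lemma affine_fp_s a : affine_function (fun z => fp_s z a : R).
Proof. by move=> t z w; rewrite /fp_s /= !ffunE. Qed.

Lemma affine_fp_b k : affine_function (fun z => fp_b z k : R).
Proof. by move=> t z w; rewrite /fp_b /= !ffunE. Qed.

Lemma affine_fp_gamma : affine_function (@fp_gamma R n d N).
Proof. by []. Qed.

Lemma affine_fp_v : affine_function (@fp_v R n d N).
Proof. by []. Qed.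

Lemma convex_quadratic_form (a p : R) : 0 < a ->
  (#|Gamma n d| + N)%:R * p ^+ 2 <= 4 * a ->
  @convex_function R V setT (fun z =>
    a * (\sum_i fp_s z i ^+ 2 + \sum_k fp_b z k ^+ 2)
    + p * fp_v z * (\sum_i fp_s z i + \sum_k fp_b z k) + fp_v z ^+ 2).
Proof.
(* The shift [h] solves [2 * a * h = p], so the squares reproduce the cross term; they overshoot by
   [K * a * h ^+ 2 = K * p ^+ 2 / (4 * a)] times [fp_v z ^+ 2], where K is [#|Gamma n d| + N], and
   [pa] bounds this coefficient by 1. *)
move=> a0 pa; pose h := p / (2 * a).
have afv := affineZ h affine_fp_v.
have -> : (fun z : V => a * (\sum_i fp_s z i ^+ 2 + \sum_k fp_b z k ^+ 2)
    + p * fp_v z * (\sum_i fp_s z i + \sum_k fp_b z k) + fp_v z ^+ 2)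
  = (fun z : V => a * (\sum_i (fp_s z i + h * fp_v z) ^+ 2
        + \sum_k (fp_b z k + h * fp_v z) ^+ 2)
      + (1 - (#|Gamma n d| + N)%:R * p ^+ 2 / (4 * a)) * fp_v z ^+ 2).
  apply/funext => z; rewrite !sum_sqr_shift card_ord natrD /h; field.
  by rewrite gt_eqF.
apply: convexD; apply: convexZ.
- exact: ltW.
- apply: convexD; apply: convex_sum => i; apply: convex_sqr; apply: affineD => //.
    exact: affine_fp_s.
  exact: affine_fp_b.
- by rewrite subr_ge0 ler_pdivrMr ?mul1r// mulr_gt0.
- exact: convex_sqr affine_fp_v.
Qed.

Lemma ellipsoid_convex (x : 'I_N -> 'rV[R]_n) (y : 'I_N -> R)
    (M rho : R) (lb lm : nat) :
  (0 < N)%N -> 1 + Num.sqrt (#|Gamma n d| + N)%:R / 2 <= rho ->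
  convex_constraint (@fp_constraint R n d N x y M rho lb lm Ellipsoid).
Proof.
move=> N_gt0 rho_ge.
(* Positivity of K makes [rho > 1] strict, so that [Num.sqrt (rho - 1)] is a genuine divisor. *)
have K_gt0 : 0 < (#|Gamma n d| + N)%:R :> R by rewrite ltr0n addn_gt0 N_gt0 orbT.
have sqrtK_gt0 : 0 < Num.sqrt (#|Gamma n d| + N)%:R :> R by rewrite sqrtr_gt0.
have rho1_gt0 : 0 < rho - 1 by lra.
have rho_gt0 : 0 < rho by lra.
have rho1_neq0 : rho - 1 != 0 by rewrite gt_eqF.
have rho_neq0 : rho != 0 by rewrite gt_eqF.
apply: convexD; last exact/convex_affine/affine_cst.
have -> : (fun z : V =>
    (rho - 1) * (enorm (fp_s z) ^+ 2 + enorm (fp_b z) ^+ 2) / rho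
    + fp_v z / (Num.sqrt rho * Num.sqrt (rho - 1))
      * (\sum_(a : Gamma n d) fp_s z a + \sum_(k < N) fp_b z k)
    + fp_v z ^+ 2)
  = (fun z => (rho - 1) / rho
      * (\sum_i fp_s z i ^+ 2 + \sum_k fp_b z k ^+ 2)
    + (Num.sqrt rho * Num.sqrt (rho - 1))^-1 * fp_v z
      * (\sum_i fp_s z i + \sum_k fp_b z k) + fp_v z ^+ 2).
  apply/funext => z; rewrite !enorm_sqr [_^-1 * fp_v z]mulrC.
  by rewrite (mulrAC (rho - 1)).
apply: convex_quadratic_form; first exact: divr_gt0.
(* Here [p ^+ 2] is the inverse of [rho * (rho - 1)], so the condition on [p] and [a] becomes K at
   most [(2 * (rho - 1)) ^+ 2]; taking square roots gives [rho_ge]. *)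
rewrite exprVn exprMn !sqr_sqrtr ?(ltW rho_gt0) ?(ltW rho1_gt0)//.
rewrite ler_pdivrMr ?mulr_gt0//.
have -> : 4 * ((rho - 1) / rho) * (rho * (rho - 1)) = (2 * (rho - 1)) ^+ 2.
  by field.
rewrite -[leLHS]sqr_sqrtr ?(ltW K_gt0)// ler_sqr ?nnegrE; lra.
Qed.

Lemma fp_constraint_convex (x : 'I_N -> 'rV[R]_n) (y : 'I_N -> R)
    (M rho : R) (lb lm : nat) (l : fp_label n d N) :
  (0 < N)%N -> 1 + Num.sqrt (#|Gamma n d| + N)%:R / 2 <= rho ->
  l <> ReverseBall -> convex_constraint (fp_constraint x y M rho lb lm l).
Proof.
move=> N_gt0 rho_ge; case: l => [k|a|a|a|a|k|k|||||] // _.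
- apply: convexD; last exact/convex_affine/affineN/affine_fp_gamma.
  apply: convexD.
    apply/convex_affine/affineD; apply: affineZ => //; exact: affine_fp_b.
  apply/convex_norm/affineD; first exact/affineZ/affine_fp_v.
  apply/affineN/affine_sum => a; exact/affineZr/affine_fp_c.
- apply/convex_affine/affineD; first exact/affineN/affineZ/affine_fp_s.
  exact/affineN/affine_fp_c.
- apply/convex_affine/affineD; first exact: affine_fp_c.
  exact/affineN/affineZ/affine_fp_s.
- apply/convex_affine/affineD; first exact: affine_cst.
  exact/affineN/affine_fp_s.
- apply/convex_affine/affineD; first exact: affine_fp_s.
  exact/affineN/affineZ/affine_fp_v.
- apply/convex_affine/affineD; first exact: affine_cst.
  exact/affineN/affine_fp_b.
- apply/convex_affine/affineD; first exact: affine_fp_b.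
  exact/affineN/affineZ/affine_fp_v.
- apply: affineD; first by apply: affine_sum => k; exact: affine_fp_b.
  exact/affineN/affineZ/affine_fp_v.
- apply: affineD; first by apply: affine_sum => a; exact: affine_fp_s.
  exact/affineN/affineZ/affine_fp_v.
- by apply: affineD; [exact: affine_fp_v|exact: affine_cst].
- exact: ellipsoid_convex.
Qed.

Lemma reverse_ball_not_convex (x : 'I_N -> 'rV[R]_n) (y : 'I_N -> R)
    (M rho : R) (lb lm : nat) :
  ~ @convex_set R V
      (satisfying (@fp_constraint R n d N x y M rho lb lm ReverseBall)).
Proof.
(* With every coordinate but v zero, both [e] and [- e] satisfy the constraint with equality,
   whatever the data. *)
pose e : V := (0, 0, 0, 0, 1).
have h01 : 0 <= 2^-1 :> R /\ 2^-1 <= 1 :> R by split; lra.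
move=> /(_ e (- e) (Itv01 h01.1 h01.2)).
have enorm0 (I : finType) : enorm (0 : {ffun I -> R^o}) ^+ 2 = 0.
  by rewrite enorm_sqr big1// => i _; rewrite ffunE expr0n.
have -> : conv (Itv01 h01.1 h01.2) (e : convex_lmodType V) (- e) = 0 :> V.
  rewrite /conv /= scalerN -scalerBl [X in X *: _](_ : _ = 0) ?scale0r//.
  (* The combination of [e] and [- e] has coefficient [t - (1 - t)], which vanishes at one half;
     [change] exposes the weights as reals. *)
  by change (2^-1 - (1 - 2^-1) = 0 :> R); field.
rewrite !inE /= /fp_s /fp_b /fp_v /= !oppr0 !enorm0 sqrrN expr1n expr0n !add0r.
by move=> /(_ (lexx _) (lexx _)); rewrite ler10.
Qed.

End FractionalProgramConvexity.

Theorem theorem3p1 (R : realType) (n d N : nat)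
    (n_gt0 : (0 < n)%N) (d_gt0 : (0 < d)%N) (N_gt0 : (0 < N)%N)
    (x : 'I_N -> 'rV[R]_n) (y : 'I_N -> R)
    (M rho : R) (lb lm : nat)
    (M_gt0 : 0 < M) (lb_gt0 : (0 < lb)%N) (lm_gt0 : (0 < lm)%N)
    (rho_gt0 : 0 < rho)
    (rho_ge : 1 + Num.sqrt (#|Gamma n d| + N)%:R / 2 <= rho) :
  let FP := @fp_constraint R n d N x y M rho lb lm in
  [/\ @convex_function R (fp_space R n d N)
        (satisfying (FP VFixed)) fp_objective,
      forall l : fp_label n d N,
        convex_constraint (FP l) <-> l <> ReverseBall
    & ~ @convex_set R (fp_space R n d N)
          (satisfying (FP ReverseBall))].
Proof.
move=> FP; split; last exact: reverse_ball_not_convex.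
  exact: (@convex_quotient_fixed_denominator R _ _ _ (Num.sqrt (rho - 1)
    / Num.sqrt (rho * (#|Gamma n d| + N + 1)%:R - 1)) affine_fp_gamma
    affine_fp_v).
move=> l; split=> [cl lE|].
  (* If the constraint labelled [ReverseBall] were convex, its solution set would be convex too. *)
  apply: (@reverse_ball_not_convex R n d N x y M rho lb lm).
  by apply: convex_constraint_Leq_set; rewrite lE in cl.
exact: fp_constraint_convex.
Qed.
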